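(* Let $X$ be a compact metric space, let $f,g:X\to X$ be continuous maps, and let $\boldsymbol{f}=(f,g,f,g,\dots)$ and $\boldsymbol{g}=(g,f,g,f,\dots)$ be the alternating non-autonomous dynamical systems. Then $$\mathrm{mdim}(X,\boldsymbol{f})=\mathrm{mdim}(X,\boldsymbol{g}).$$ Therefore $$\mathrm{mdim}(X,f\circ g)=\mathrm{mdim}(X,g\circ f).$$
   Context: A non-autonomous dynamical system on a compact metric space $X$ is a sequence $\boldsymbol{f}=(f_n)_{n=1}^\infty$ of continuous maps $f_n:X\to X$. Write $f_n^{(0)}=\mathrm{id}_X$ and $f_n^{(k)}=f_{n+k-1}\circ\cdots\circ f_n$ for $k\ge 1$. For open covers $\alpha,\beta$ of $X$: $\beta\succ\alpha$ means that $\beta$ is finer than $\alpha$, and $\alpha\vee\beta$ is the cover by the intersections $U\cap V$, $U\in\alpha$, $V\in\beta$. Put $\mathrm{ord}(\alpha)=\sup_{x\in X}\sum_{U\in\alpha}1_U(x)-1$ and $\mathcal D(\alpha)=\min_{\beta\succ\alpha}\mathrm{ord}(\beta)$, the minimum being over open covers $\beta$ of $X$ finer than $\alpha$. Put $\alpha_0^{n-1}=\alpha\vee (f_1^{(1)})^{-1}(\alpha)\vee\cdots\vee(f_1^{(n-1)})^{-1}(\alpha)$. The mean dimension is $$\mathrm{mdim}(X,\boldsymbol{f})=\sup_\alpha\lim_{n\to\infty}\frac{\mathcal D(\alpha_0^{n-1})}{n},$$ the supremum being over open covers $\alpha$ of $X$ (the limit is taken to exist). For a single continuous map $\phi:X\to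 X$, $\mathrm{mdim}(X,\phi)$ is the mean dimension of the constant sequence $(\phi,\phi,\dots)$. *)

(* Defs.v *)
From mathcomp Require Import all_boot all_order all_algebra.
From mathcomp Require Import all_classical all_reals all_analysis.

Set Implicit Arguments.
Unset Strict Implicit.
Unset Printing Implicit Defensive.

Import Order.TTheory GRing.Theory Num.Theory.
Local Open Scope classical_set_scope.
Local Open Scope ring_scope.

Definition open_cover (X : topologicalType) (alpha : set (set X)) : Prop :=
  (forall U, alpha U -> open U) /\ \bigcup_(U in alpha) U = [set: X].

Definition finer (X : Type) (beta alpha : set (set X)) : Prop :=
  forall V, beta V -> exists2 U, alpha U & V `<=` U.

Definition cover_join (X : Type) (alpha beta : set (set X)) : set (set X) :=
  [set U `&` V | U in alpha & V in beta].

Definition cover_preimage (X : Type) (h : X -> X) (alpha : set (set X)) :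
  set (set X) := [set h @^-1` U | U in alpha].

(* Extended-real valued: +oo when the multiplicities are unbounded, and -oo
   (the supremum over no points) on the empty space. *)
Definition cover_ord (R : realType) (X : metricType R) (alpha : set (set X)) :
    \bar R :=
  (ereal_sup [set \esum_(U in alpha) (\1_U x : R)%:E | x in [set: X]] - 1)%E.

(* The infimum is attained: every value of [cover_ord] is an integer >= 0,
   +oo, or, on the empty space, -oo. *)
Definition cover_D (R : realType) (X : metricType R) (alpha : set (set X)) :
    \bar R :=
  ereal_inf [set cover_ord beta | beta in
    [set beta | open_cover beta /\ finer beta alpha]].

(* A non-autonomous system (f_n)_{n >= 1} is indexed from 0, [F n] being
   f_{n+1}; [nads_iter F n k] is f_{n+1}^{(k)}. *)
Fixpoint nads_iter (X : Type) (F : nat -> X -> X) (n k : nat) : X -> X :=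
  if k is k'.+1 then F (n + k')%N \o nads_iter F n k' else id.

(* [cover_iter F alpha n] is alpha_0^n, the join of the n + 1 covers
   (f_1^{(k)})^{-1}(alpha) for 0 <= k <= n. *)
Fixpoint cover_iter (X : Type) (F : nat -> X -> X) (alpha : set (set X))
    (n : nat) : set (set X) :=
  if n is n'.+1 then
    cover_join (cover_iter F alpha n')
               (cover_preimage (nads_iter F 0 n'.+1) alpha)
  else alpha.

(* The sequence is indexed from 0, its terms being
   D(alpha_0^{n-1}) / n for n >= 1. *)
Definition mdim_nads (R : realType) (X : metricType R) (F : nat -> X -> X) :
    \bar R :=
  ereal_sup [set limn (fun n : nat =>
      (cover_D (cover_iter F alpha n) / (n.+1%:R : R)%:E)%E)
    | alpha in [set alpha : set (set X) | open_cover alpha]].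

Definition mdim (R : realType) (X : metricType R) (phi : X -> X) : \bar R :=
  mdim_nads (fun _ : nat => phi).

Definition alternating_nads (X : Type) (f g : X -> X) : nat -> X -> X :=
  fun n => if odd n then g else f.

(* Main.v *)
From HB Require Import structures.
Require Import Defs.
From mathcomp Require Import all_boot all_order all_algebra.
From mathcomp Require Import all_classical all_reals all_analysis.
From mathcomp Require Import zify lra.

(* D is subadditive under joins, non-increasing under preimages and monotone.
   For subadditivity, take finite open covers s and t with sums of distance
   functions subdividing, at each point x, one and the same interval in two
   ways, the nondegenerate pieces being indexed by the members of s, resp. t,
   that contain x. The pairs of pieces that overlap in more than a point define
   an open cover finer than the join; if p and q pieces are nondegenerate at x,
   the common subdivision has at most p + q - 1 pieces, so orders add up.

   The covers alpha_0^n of f = (f, g, ...) and g = (g, f, ...) satisfy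
   alpha_0^(n+1)(f) = alpha v f^-1(alpha_0^n(g)) and symmetrically, so their D
   differ by at most D(alpha), which disappears after division by n. In the same
   way the covers alpha_0^n of f o g and (f^-1 alpha)_0^n of g o f, the latter
   being f^-1 of the former, have values of D that differ by at most
   D(alpha). *)

Set Implicit Arguments.
Unset Strict Implicit.
Unset Printing Implicit Defensive.

Import Order.TTheory GRing.Theory Num.Theory.
Local Open Scope classical_set_scope.
Local Open Scope ring_scope.

(** * Joins, preimages and iterated covers *)

Lemma cover_joinA (X : Type) (a b c : set (set X)) :
  cover_join a (cover_join b c) = cover_join (cover_join a b) c.
Proof.
apply/seteqP; split=> [_ [U aU [_ [V bV [W cW <-]] <-]]|].
  by exists (U `&` V); [exists U => //; exists V|exists W; rewrite ?setIA].
move=> _ [_ [U aU [V bV <-]] [W cW <-]].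
by exists U => //; exists (V `&` W); [exists V => //; exists W|rewrite setIA].
Qed.

Lemma cover_preimage_join (X : Type) (h : X -> X) (a b : set (set X)) :
  cover_preimage h (cover_join a b) =
  cover_join (cover_preimage h a) (cover_preimage h b).
Proof.
apply/seteqP; split=> [_ [_ [U aU [V bV <-]] <-]|].
  by exists (h @^-1` U); [exists U|exists (h @^-1` V); [exists V|]].
move=> _ [_ [U aU <-] [_ [V bV <-] <-]].
by exists (U `&` V) => //; exists U => //; exists V.
Qed.

Lemma cover_preimage_comp (X : Type) (h k : X -> X) (a : set (set X)) :
  cover_preimage h (cover_preimage k a) = cover_preimage (k \o h) a.
Proof.
apply/seteqP; split=> [_ [_ [U aU <-] <-]|_ [U aU <-]]; first by exists U.
by exists (k @^-1` U) => //; exists U.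
Qed.

Lemma nads_iterSr (X : Type) (F : nat -> X -> X) (k : nat) :
  nads_iter F 0 k.+1 = nads_iter (F \o S) 0 k \o F 0%N.
Proof. by elim: k => [//|k IH]; rewrite /= -compA -IH. Qed.

(** Every iterate but the zeroth factors through [F 0], by [nads_iterSr], so the corresponding part
    of the join is a preimage under [F 0]. *)
Lemma cover_iterS (X : Type) (F : nat -> X -> X) (a : set (set X)) (n : nat) :
  cover_iter F a n.+1 =
  cover_join a (cover_preimage (F 0%N) (cover_iter (F \o S) a n)).
Proof.
elim: n => [//|n IH].
rewrite [LHS]/= -/(cover_iter F a n.+1) IH -cover_joinA; congr cover_join.
rewrite -/(nads_iter F 0 n.+2) nads_iterSr -cover_preimage_comp.
by rewrite -cover_preimage_join.
Qed.

(** The intertwining relation passes to all iterates. It serves for [f], which intertwines [g \o f]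
    with [f \o g]. *)
Lemma cover_iter_preimage (X : Type) (h : X -> X) (F G : nat -> X -> X)
    (a : set (set X)) (n : nat) :
  (forall k, h \o F k = G k \o h) ->
  cover_iter F (cover_preimage h a) n = cover_preimage h (cover_iter G a n).
Proof.
move=> hFG; have hiter k : h \o nads_iter F 0 k = nads_iter G 0 k \o h.
  by elim: k => [//|k IH]; rewrite /= compA hFG -compA IH.
elim: n => [//|n IH].
by rewrite /= IH cover_preimage_join !cover_preimage_comp -!/(nads_iter _ 0 n.+1)
  hiter.
Qed.

Lemma open_cover_preimage (X : topologicalType) (h : X -> X) (a : set (set X)) :
  continuous h -> open_cover a -> open_cover (cover_preimage h a).
Proof.
move=> hcont [aopen acover]; split=> [_ [U aU <-]|].
  by apply: open_comp; [move=> x _; exact: hcont|exact: aopen].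
apply/seteqP; split=> // x _.
have : [set: X] (h x) by [].
by rewrite -acover => -[U aU Uhx]; exists (h @^-1` U) => //; exists U.
Qed.

Lemma open_cover_join (X : topologicalType) (a b : set (set X)) :
  open_cover a -> open_cover b -> open_cover (cover_join a b).
Proof.
move=> [aopen acover] [bopen bcover]; split=> [_ [U aU [V bV <-]]|].
  by apply: openI; [exact: aopen|exact: bopen].
apply/seteqP; split=> // x _.
have : [set: X] x by [].
rewrite -{1}acover => -[U aU Ux].
have : [set: X] x by [].
by rewrite -bcover => -[V bV Vx]; exists (U `&` V) => //; exists U => //; exists V.
Qed.

Lemma open_cover_iter (X : topologicalType) (F : nat -> X -> X)
    (a : set (set X)) (n : nat) :
  (forall k, continuous (F k)) -> open_cover a -> open_cover (cover_iter F a n).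
Proof.
move=> Fcont acov; elim: n F Fcont => [//|n IH] F Fcont; rewrite cover_iterS.
apply: open_cover_join => //; apply: open_cover_preimage => //.
by apply: IH => k; exact: (Fcont k.+1).
Qed.

(** * Counting the points of a staircase *)

Lemma ltn_count_iota (A : pred nat) (i j : nat) :
  (i < j)%N -> A i -> (count A (iota 0 i) < count A (iota 0 j))%N.
Proof.
move=> ij Ai; rewrite -(subnKC ij) addSnnS iotaD count_cat /= add0n Ai.
by rewrite -addn1 leq_add2l.
Qed.

(* The pairs related by [P] form a chain for the product order, along which the
   sum of the ranks in [A] and [B] is strictly increasing. *)
Lemma count_staircase (A B : pred nat) (P : rel nat) (p q : nat) :
  has A (iota 0 p) ->
  (forall i j, P i j -> A i /\ B j) ->
  (forall i j i' j', P i j -> P i' j' -> (i < i')%N -> (j <= j')%N) ->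
  (count (fun ij => P ij.1 ij.2)
     [seq (i, j) | i <- iota 0 p, j <- iota 0 q] <
   count A (iota 0 p) + count B (iota 0 q))%N.
Proof.
rewrite has_count => A_gt0 PAB Pchain.
rewrite -size_filter; set K := seq.filter _ _.
set a := count A _; set b := count B _.
pose r (ij : nat * nat) := (count A (iota 0 ij.1) + count B (iota 0 ij.2))%N.
have KP i j : (i, j) \in K -> [/\ P i j, (i < p)%N & (j < q)%N].
  rewrite mem_filter => /andP[/= Pij /allpairsP[[i' j'] /=]].
  by rewrite !mem_iota => -[ip jq [iE jE]]; rewrite -iE in ip; rewrite -jE in jq.
have rlt i j i' j' : (i, j) \in K -> (i', j') \in K -> (i < i')%N ->
    (r (i, j) < r (i', j'))%N.
  move=> /KP[Pij _ _] /KP[Pij' _ _] ii'.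
  have [Ai Bj] := PAB _ _ Pij; rewrite /r /=.
  have := ltn_count_iota ii' Ai.
  have := Pchain _ _ _ _ Pij Pij' ii'; rewrite leq_eqVlt => /orP[/eqP->|jj'].
    by lia.
  by have := ltn_count_iota jj' Bj; lia.
have rinj : {in K &, injective r}.
  move=> [i j] [i' j'] Kij Kij' rE.
  have [ii'|ii'|ii'] := ltngtP i i'.
  - by have := rlt _ _ _ _ Kij Kij' ii'; rewrite rE ltnn.
  - by have := rlt _ _ _ _ Kij' Kij ii'; rewrite rE ltnn.
  rewrite -{i'}ii' in Kij' rE *; congr pair.
  have [[Pij _ _] [Pij' _ _]] := (KP _ _ Kij, KP _ _ Kij').
  have [[_ Bj] [_ Bj']] := (PAB _ _ Pij, PAB _ _ Pij').
  by have [jj'|jj'|//] := ltngtP j j';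
    [have := ltn_count_iota jj' Bj|have := ltn_count_iota jj' Bj'];
    move: rE; rewrite /r /=; lia.
have Kuniq : uniq K.
  by apply/filter_uniq/allpairs_uniq; rewrite ?iota_uniq// => -[? ?] [? ?].
(* An [i] in [A] is counted by [a] but not by its own rank, and likewise for [B]. So ranks are at
   most [a - 1] and [b - 1], and [r] takes at most [a + b - 1] values on [K]. *)
suff : (size (map r K) <= size (iota 0 (a + b).-1))%N.
  by rewrite size_map size_iota; lia.
apply: uniq_leq_size => [|_ /mapP[[i j] Kij ->]]; first by rewrite map_inj_in_uniq.
have [Pij ip jq] := KP _ _ Kij; have [Ai Bj] := PAB _ _ Pij.
rewrite mem_iota /r /=.
have := ltn_count_iota ip Ai; have := ltn_count_iota jq Bj.
rewrite -/a -/b; lia.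
Qed.

(** * Subdivisions built from distance functions *)

(* Capping at 1 keeps the infimum over a nonempty set when [U] is the whole
   space. *)
Definition dist_compl (R : realType) (X : metricType R) (U : set X) (x : X) : R :=
  inf (1 |` [set mdist x y | y in ~` U]).

Lemma dist_compl_has_lbound (R : realType) (X : metricType R) (U : set X) (x : X) :
  lbound (1 |` [set mdist x y | y in ~` U]) (0 : R).
Proof. by move=> _ [->|[y _ <-]]; rewrite ?ler01 ?mdist_ge0. Qed.

Lemma dist_compl_ge0 (R : realType) (X : metricType R) (U : set X) (x : X) :
  0 <= dist_compl U x.
Proof.
by apply: lb_le_inf; [exists 1; left|exact: dist_compl_has_lbound].
Qed.

Lemma dist_compl_gt0 (R : realType) (X : metricType R) (U : set X) (x : X) :
  open U -> (0 < dist_compl U x) = (x \in U).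
Proof.
move=> Uopen; apply/idP/idP => [d0|/set_mem Ux].
  apply: contraTT d0 => /negP xU; rewrite -leNgt.
  apply: ge_inf; first by exists 0; exact: dist_compl_has_lbound.
  by right; exists x; rewrite ?mdistxx// => Ux; apply: xU; rewrite inE.
have := open_nbhs_nbhs (conj Uopen Ux).
move=> /nbhs_ballP[e /= e0]; rewrite ballEmdist => eU.
apply: (@lt_le_trans _ _ (Num.min 1 e)); first by rewrite lt_min ltr01.
apply: lb_le_inf; first by exists 1; left.
move=> _ [->|[y Uy <-]]; rewrite ge_min ?lexx//.
by rewrite orbC leNgt; case: ltP => // xy; case: Uy; exact: eU.
Qed.

Lemma dist_compl_lip (R : realType) (X : metricType R) (U : set X) (x y : X) :
  dist_compl U x <= mdist x y + dist_compl U y.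
Proof.
rewrite -lerBlDl; apply: lb_le_inf; first by exists 1; left.
have lb z : has_lbound (1 |` [set mdist z y | y in ~` U] : set R).
  by exists 0; exact: dist_compl_has_lbound.
move=> _ [->|[z Uz <-]]; rewrite lerBlDl.
  apply: (@le_trans _ _ 1); last by rewrite lerDr mdist_ge0.
  by apply: ge_inf => //; left.
apply: le_trans (metric_triangle x y z).
by apply: ge_inf => //; right; exists z.
Qed.

Lemma dist_compl_continuous (R : realType) (X : metricType R) (U : set X) :
  continuous (dist_compl U : X -> R^o).
Proof.
move=> x; apply/cvgrPdist_lt => e e0.
near=> y.
have xy : mdist x y < e.
  near: y; apply/nbhs_ballP; exists e => //= y.
  by rewrite ballEmdist.
have := dist_compl_lip U x y; have := dist_compl_lip U y x.
rewrite (metric_sym y x) ltr_norml => h1 h2.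
by apply/andP; split; lra.
Unshelve. all: by end_near.
Qed.

Definition cum_dist (R : realType) (X : metricType R) (s : seq (set X))
    (i : nat) (x : X) : R := \sum_(k < i) dist_compl (nth set0 s k) x.

Lemma cum_dist_continuous (R : realType) (X : metricType R) (s : seq (set X))
    (i : nat) : continuous (cum_dist s i : X -> R^o).
Proof.
apply: (continuous_big (op := +%R : R^o -> R^o -> R^o)).
  exact: add_continuous.
by move=> k _; exact: dist_compl_continuous.
Qed.

Lemma cum_distS (R : realType) (X : metricType R) (s : seq (set X))
    (i : nat) (x : X) :
  cum_dist s i.+1 x = cum_dist s i x + dist_compl (nth set0 s i) x.
Proof. exact: big_ord_recr. Qed.

Lemma cum_dist_ge0 (R : realType) (X : metricType R) (s : seq (set X))
    (i : nat) (x : X) : 0 <= cum_dist s i x.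
Proof. by apply: sumr_ge0 => k _; exact: dist_compl_ge0. Qed.

Lemma cum_dist_homo (R : realType) (X : metricType R) (s : seq (set X)) (x : X) :
  {homo (cum_dist s)^~ x : i j / (i <= j)%N >-> i <= j}.
Proof.
apply: homo_leq => [//|j i k|i]; first exact: le_trans.
by rewrite cum_distS lerDl dist_compl_ge0.
Qed.

Definition scaled_dist (R : realType) (X : metricType R) (s t : seq (set X))
    (i : nat) (x : X) : R := cum_dist s i x * cum_dist t (size t) x.

Lemma scaled_dist_homo (R : realType) (X : metricType R) (s t : seq (set X))
    (x : X) : {homo (scaled_dist s t)^~ x : i j / (i <= j)%N >-> i <= j}.
Proof.
by move=> i j ij; rewrite ler_wpM2r ?cum_dist_ge0// cum_dist_homo.
Qed.

Lemma scaled_dist_continuous (R : realType) (X : metricType R)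
    (s t : seq (set X)) (i : nat) : continuous (scaled_dist s t i : X -> R^o).
Proof.
move=> x; apply: (@continuousM R X); exact: cum_dist_continuous.
Qed.

(* [cum_dist] cuts an interval into consecutive pieces, one for each member of
   the cover; the factors in [scaled_dist] rescale the subdivisions coming from
   [s] and [t] to the same total length. The pair [(i, j)] is selected at [x]
   when the [i]-th piece of the first one and the [j]-th piece of the second
   one overlap. *)
Definition stair (R : realType) (X : metricType R) (s t : seq (set X))
    (i j : nat) : set X :=
  [set x | Num.max (scaled_dist s t i x) (scaled_dist t s j x) <
           Num.min (scaled_dist s t i.+1 x) (scaled_dist t s j.+1 x)].

Lemma stair_sym (R : realType) (X : metricType R) (s t : seq (set X))
    (i j : nat) : stair s t i j = stair t s j i.
Proof. by apply/seteqP; split=> x; rewrite /stair /= maxC minC. Qed.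

Lemma open_stair (R : realType) (X : metricType R) (s t : seq (set X))
    (i j : nat) : open (stair s t i j).
Proof.
pose h (x : X) : R^o :=
  Num.min (scaled_dist s t i.+1 x) (scaled_dist t s j.+1 x) -
  Num.max (scaled_dist s t i x) (scaled_dist t s j x).
have -> : stair s t i j = h @^-1` [set r | 0 < r].
  by apply/seteqP; split=> x; rewrite /= /h subr_gt0.
apply: open_comp; last exact: open_gt.
move=> x _; apply: (@continuousB R R^o X).
  by apply: continuous_min; exact: scaled_dist_continuous.
by apply: continuous_max; exact: scaled_dist_continuous.
Qed.

Lemma stair_sub (R : realType) (X : metricType R) (s t : seq (set X))
    (i j : nat) (x : X) :
  (forall U, U \in s -> open U) -> stair s t i j x ->
  x \in nth set0 s i.
Proof.
move=> sopen; rewrite /stair /= gt_max !lt_min => /andP[/andP[+ _] _].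
rewrite /scaled_dist cum_distS mulrDl ltrDl => d_gt0.
have : 0 < dist_compl (nth set0 s i) x.
  rewrite lt_def dist_compl_ge0 andbT; apply: contraTneq d_gt0 => ->.
  by rewrite mul0r ltxx.
(* Beyond the end of [s], [nth] returns the empty set, which is open as well. *)
rewrite dist_compl_gt0//; have [ilt|ige] := ltnP i (size s).
  by apply: sopen; exact: mem_nth.
by rewrite nth_default//; exact: open0.
Qed.

(** Write s_k and t_k for the cut points at [x]. If [j' < j], the two overlaps would give t_j <
    s_(i+1) <= s_i' < t_(j'+1) <= t_j. *)
Lemma stair_chain (R : realType) (X : metricType R) (s t : seq (set X))
    (i j i' j' : nat) (x : X) :
  stair s t i j x -> stair s t i' j' x -> (i < i')%N -> (j <= j')%N.
Proof.
rewrite /stair /= !gt_max !lt_min => /andP[_ /andP[h1 _]] /andP[/andP[_ h2] _] ii'.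
rewrite leqNgt; apply/negP => jj'.
have := scaled_dist_homo s t x ii'; have := scaled_dist_homo t s x jj'.
by move: h1 h2; lra.
Qed.

(** Members before the first one containing [x] contribute pieces of length zero, so the first
    nondegenerate piece starts at 0. *)
Lemma cum_dist_find (R : realType) (X : metricType R) (s : seq (set X)) (x : X) :
  (forall U, U \in s -> open U) -> has (fun U => x \in U) s ->
  let i := find (fun U => x \in U) s in
  [/\ cum_dist s i x = 0, 0 < cum_dist s i.+1 x & 0 < cum_dist s (size s) x].
Proof.
move=> sopen hass i.
have ilt : (i < size s)%N by rewrite -has_find.
have di : 0 < cum_dist s i.+1 x.
  rewrite cum_distS ltr_wpDl ?cum_dist_ge0// dist_compl_gt0.
    exact: (nth_find set0 hass).
  by apply: sopen; exact: mem_nth.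
split=> //; last by apply: lt_le_trans di _; exact: cum_dist_homo.
apply: big1 => k _; apply/eqP; rewrite eq_le dist_compl_ge0 andbT leNgt.
have kn := ltn_ord k.
rewrite dist_compl_gt0; first by have /= -> := before_find set0 kn.
by apply: sopen; apply: mem_nth; exact: ltn_trans ilt.
Qed.

(** The first nondegenerate pieces of both subdivisions start at 0, hence overlap; the positive
    total lengths keep the rescaling from collapsing them. *)
Lemma stair_cover (R : realType) (X : metricType R) (s t : seq (set X)) (x : X) :
  (forall U, U \in s -> open U) -> (forall U, U \in t -> open U) ->
  has (fun U => x \in U) s -> has (fun U => x \in U) t ->
  stair s t (find (fun U => x \in U) s) (find (fun U => x \in U) t) x.
Proof.
move=> sopen topen hass hast.
have [s0 s1 sT] := cum_dist_find sopen hass.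
have [t0 t1 tT] := cum_dist_find topen hast.
by rewrite /stair /= /scaled_dist s0 t0 !mul0r maxxx lt_min !mulr_gt0.
Qed.

(** * Refinements of bounded multiplicity *)

(** For compact [X] this expresses D(a) <= n. A list may repeat members, which only raises the
    count, so the members of a constructed cover need not be shown distinct. *)
Definition refinable (X : topologicalType) (a : set (set X)) (n : nat) : Prop :=
  exists s : seq (set X), [/\ open_cover [set` s], finer [set` s] a &
    forall x, (count (fun U => x \in U) s <= n.+1)%N].

Lemma open_cover_has (X : topologicalType) (s : seq (set X)) (x : X) :
  open_cover [set` s] -> has (fun U => x \in U) s.
Proof.
move=> [_ scover]; have : [set: X] x by [].
by rewrite -scover => -[U /= Us Ux]; apply/hasP; exists U; rewrite ?inE.
Qed.

Lemma refinable_join (R : realType) (X : metricType R) (a b : set (set X))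
    (m n : nat) :
  refinable a m -> refinable b n -> refinable (cover_join a b) (m + n).
Proof.
move=> [s [scov sa sm]] [t [tcov tb tn]].
have sopen U : U \in s -> open U by exact: scov.1.
have topen U : U \in t -> open U by exact: tcov.1.
have shas x := open_cover_has x scov; have thas x := open_cover_has x tcov.
exists [seq stair s t ij.1 ij.2 |
  ij <- [seq (i, j) | i <- iota 0 (size s), j <- iota 0 (size t)]]; split.
- split=> [_ /= /mapP[ij _ ->]|]; first exact: open_stair.
  apply/seteqP; split=> // x _.
  have := stair_cover sopen topen (shas x) (thas x).
  set i := find _ s; set j := find _ t => ijx; exists (stair s t i j) => //=.
  apply/mapP; exists (i, j) => //.
  by apply: allpairs_f; rewrite mem_iota /= -has_find.
- move=> _ /= /mapP[_ /allpairsP[[i j] [+ + ->]] ->].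
  rewrite /= !mem_iota /= !add0n => ilt jlt.
  have [U aU sU] := sa _ (mem_nth set0 ilt).
  have [V bV tV] := tb _ (mem_nth set0 jlt).
  exists (U `&` V); first by exists U => //; exists V.
  move=> x ijx; split.
    by apply: sU; have := stair_sub sopen ijx; rewrite inE.
  by apply: tV; move: ijx; rewrite stair_sym => /(stair_sub topen); rewrite inE.
move=> x; rewrite count_map.
have countE u : count (fun U => x \in U) u =
    count (fun i => x \in nth set0 u i) (iota 0 (size u)).
  by rewrite -[in LHS](mkseq_nth set0 u) count_map.
have stairP i j : x \in stair s t i j -> x \in nth set0 s i /\ x \in nth set0 t j.
  move=> /set_mem ijx; split; first exact: stair_sub ijx.
  by apply: (@stair_sub _ _ _ s _ i) => //; rewrite stair_sym.
have stair_mono i j i' j' : x \in stair s t i j -> x \in stair s t i' j' ->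
    (i < i')%N -> (j <= j')%N.
  by move=> /set_mem ijx /set_mem; exact: stair_chain ijx.
(* With at most [m + 1] and [n + 1] members through [x], the strict bound leaves at most [m + n + 1]
   pairs. *)
have := count_staircase (size t) _ stairP stair_mono.
move=> /(_ (size s)); rewrite has_count -!countE -has_count => /(_ (shas x)).
have := sm x; have := tn x; rewrite /preim /=; set c := count _ (flatten _).
lia.
Qed.

Lemma refinable_preimage (X : topologicalType) (h : X -> X) (a : set (set X))
    (n : nat) :
  continuous h -> refinable a n -> refinable (cover_preimage h a) n.
Proof.
move=> hcont [s [scov sa sn]]; exists [seq h @^-1` U | U <- s]; split.
- have -> : [set` [seq h @^-1` U | U <- s]] = cover_preimage h [set` s].
    by apply/seteqP; split=> [_ /= /mapP[U Us ->]|_ [U Us <-]];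
      [exists U|apply/mapP; exists U].
  exact: open_cover_preimage.
- move=> _ /= /mapP[V /sa[U aU VU] ->]; exists (h @^-1` U); first by exists U.
  by move=> x; exact: VU.
by move=> x; rewrite count_map; exact: (sn (h x)).
Qed.

Lemma refinable_finer (X : topologicalType) (a b : set (set X)) (n : nat) :
  finer b a -> refinable b n -> refinable a n.
Proof.
move=> ba [s [scov sb sn]]; exists s; split=> // V /sb[U /ba[W aW UW] VU].
by exists W => //; exact: subset_trans UW.
Qed.

(** * Orders of covers and integrality of D *)

Lemma esum_mult (R : realType) (X : Type) (s : seq (set X)) (x : X) :
  uniq s ->
  \esum_(U in [set` s]) (\1_U x : R)%:E =
  (count (fun U => x \in U) s)%:R%:E :> \bar R.
Proof.
move=> suniq; rewrite esum_fset; last by move=> U _; rewrite lee_fin.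
  rewrite -fsbig_seq// sumEFin; congr EFin.
  under eq_bigr do rewrite indicE.
  by rewrite -natr_sum -sum1_count [in RHS]big_mkcond.
exact: finite_seq.
Qed.

Lemma finite_subcover (X : topologicalType) (x0 : X) (a : set (set X)) :
  compact [set: X] -> open_cover a ->
  exists s : seq (set X), [/\ uniq s, [set` s] `<=` a & open_cover [set` s]].
Proof.
move=> Xcompact [aopen acover].
(* [compact_cover] is applied to a pointed space, with base point [x0]. *)
pose pX : ptopologicalType :=
  HB.pack (Topological.sort X) (isPointed.Build (Topological.sort X) x0).
have : @cover_compact pX setT by rewrite -compact_cover.
move=> /(_ _ a id aopen)[|D Da Dcov]; first by rewrite /cover acover.
exists (finmap.enum_fset D); split.
- exact: finmap.fset_uniq.
- by move=> U /= /Da; rewrite inE.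
split=> [U /= /Da|]; first by rewrite inE; exact: aopen.
by apply/seteqP; split=> // x /Dcov[U UD Ux]; exists U.
Qed.

Lemma cover_ord_le (R : realType) (X : metricType R) (a : set (set X)) (n : nat) :
  (forall x, \esum_(U in a) (\1_U x : R)%:E <= n.+1%:R%:E)%E ->
  (cover_ord a <= n%:R%:E)%E.
Proof.
move=> an; rewrite /cover_ord leeBlDr// -EFinD natr1.
by apply: ge_ereal_sup => _ [x _ <-]; exact: an.
Qed.

Lemma cover_ord_ge (R : realType) (X : metricType R) (a : set (set X)) (x : X)
    (n : nat) :
  (n.+1%:R%:E <= \esum_(U in a) (\1_U x : R)%:E)%E ->
  (n%:R%:E <= cover_ord a)%E.
Proof.
move=> an; rewrite /cover_ord leeBrDr// -EFinD natr1.
by apply: le_trans an _; apply: ereal_sup_ubound; exists x.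
Qed.

Lemma cover_D_le (R : realType) (X : metricType R) (a : set (set X)) (n : nat) :
  refinable a n -> (cover_D a <= n%:R%:E)%E.
Proof.
move=> [s [scov sa sn]]; apply: (@le_trans _ _ (cover_ord [set` s])).
  by apply: ereal_inf_lbound; exists [set` s].
apply: cover_ord_le => x.
(* The order sums over a set of members, in which a repeated one counts once. *)
have -> : [set` s] = [set` undup s].
  by apply/seteqP; split=> U /=; rewrite mem_undup.
rewrite esum_mult ?undup_uniq// lee_fin ler_nat.
by apply: leq_trans (sn x); exact: count_undup.
Qed.

(* A finite subcover has no larger order, and the multiplicities of its members
   attain a maximum at some point [x]. *)
Lemma cover_ord_refinable (R : realType) (X : metricType R) (x0 : X)
    (a : set (set X)) :
  compact [set: X] -> open_cover a ->
  exists2 n : nat, refinable a n & (n%:R%:E <= cover_ord a)%E.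
Proof.
move=> Xcompact acov.
have [s [suniq sa scov]] := finite_subcover x0 Xcompact acov.
pose c x := count (fun U => x \in U) s.
have c_gt0 x : (0 < c x)%N by rewrite -has_count; exact: open_cover_has.
have cP : exists k, `[< exists x, c x = k >] by exists (c x0); apply/asboolP; exists x0.
have cle k : `[< exists x, c x = k >] -> (k <= size s)%N.
  by move=> /asboolP[x <-]; exact: count_size.
have [_ /asboolP[x <-] cmax] := ex_maxnP cP cle.
exists (c x).-1.
  exists s; split=> // [U Us|y]; first by exists U => //; exact: sa.
  by rewrite prednK//; apply: cmax; apply/asboolP; exists y.
apply: (@cover_ord_ge _ _ _ x); rewrite prednK// -esum_mult//.
apply: esum_ge; exists [set` s]; first by split=> //; exact: finite_seq.
by rewrite -esum_fset//; exact: finite_seq.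
Qed.

(** By [cover_ord_refinable], the order of any open cover finer than [a] is at least some [m] with
    [refinable a m], so the least such number is the infimum. *)
Lemma cover_DP (R : realType) (X : metricType R) (x0 : X) (a : set (set X)) :
  compact [set: X] -> open_cover a ->
  exists2 n : nat, refinable a n & cover_D a = n%:R%:E.
Proof.
move=> Xcompact acov.
have refP : exists n, `[< refinable a n >].
  have [n an _] := cover_ord_refinable x0 Xcompact acov.
  by exists n; apply/asboolP.
have [n /asboolP an nmin] := ex_minnP refP.
exists n => //; apply/eqP; rewrite eq_le cover_D_le//=.
apply: le_ereal_inf_tmp => _ [b [bcov ba] <-].
have [m bm mle] := cover_ord_refinable x0 Xcompact bcov.
apply: le_trans mle; rewrite lee_fin ler_nat; apply: nmin.
by apply/asboolP; exact: refinable_finer bm.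
Qed.

Lemma cover_D_fin_num (R : realType) (X : metricType R) (x0 : X)
    (a : set (set X)) :
  compact [set: X] -> open_cover a -> cover_D a \is a fin_num.
Proof. by move=> Xcompact /(cover_DP x0 Xcompact)[n _ ->]. Qed.

(** * D of joins, preimages and iterated covers *)

Lemma cover_D_join (R : realType) (X : metricType R) (x0 : X)
    (a b : set (set X)) :
  compact [set: X] -> open_cover a -> open_cover b ->
  (cover_D (cover_join a b) <= cover_D a + cover_D b)%E.
Proof.
move=> Xcompact acov bcov.
have [m am ->] := cover_DP x0 Xcompact acov.
have [n bn ->] := cover_DP x0 Xcompact bcov.
by rewrite -EFinD -natrD; apply: cover_D_le; exact: refinable_join.
Qed.

Lemma cover_D_preimage (R : realType) (X : metricType R) (x0 : X) (h : X -> X)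
    (a : set (set X)) :
  compact [set: X] -> continuous h -> open_cover a ->
  (cover_D (cover_preimage h a) <= cover_D a)%E.
Proof.
move=> Xcompact hcont /(cover_DP x0 Xcompact)[n an ->].
by apply: cover_D_le; exact: refinable_preimage.
Qed.

Lemma cover_D_iter_shift (R : realType) (X : metricType R) (x0 : X)
    (F : nat -> X -> X) (a : set (set X)) (n : nat) :
  compact [set: X] -> (forall k, continuous (F k)) -> open_cover a ->
  (cover_D (cover_iter F a n.+1) <=
   cover_D a + cover_D (cover_iter (F \o S) a n))%E.
Proof.
move=> Xcompact Fcont acov; rewrite cover_iterS.
have icov : open_cover (cover_iter (F \o S) a n).
  by apply: open_cover_iter => // k; exact: (Fcont k.+1).
apply: le_trans (cover_D_join x0 Xcompact acov _) _.
  exact: open_cover_preimage.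
by rewrite leeD2l//; exact: (cover_D_preimage x0).
Qed.

(** The longer join is finer, so its infimum runs over fewer covers. *)
Lemma cover_D_iterS (R : realType) (X : metricType R)
    (F : nat -> X -> X) (a : set (set X)) (n : nat) :
  (cover_D (cover_iter F a n) <= cover_D (cover_iter F a n.+1))%E.
Proof.
apply: ereal_inf_le_tmp => _ [b [bcov ba] <-]; exists b => //; split=> //.
move=> V /ba[_ [U aU [W _ <-]] VUW]; exists U => //.
by move=> x /VUW[].
Qed.

(** * Passage to the limit and to the supremum *)

(* No existence of the limits is assumed: the two sequences converge to the same
   points, so [lim] makes the same choice for both. *)
Lemma limn_div_eq (R : realType) (u v : nat -> \bar R) (c : \bar R) :
  c \is a fin_num -> (forall n, u n \is a fin_num) ->
  (forall n, v n \is a fin_num) ->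
  (forall n, u n <= c + v n)%E -> (forall n, v n <= c + u n)%E ->
  limn (fun n => u n / (n.+1%:R : R)%:E)%E =
  limn (fun n => v n / (n.+1%:R : R)%:E)%E.
Proof.
(* One inclusion between the sets of limits suffices, by symmetry. The limit [l] may be infinite:
   the difference tends to the finite value 0, so the sum of the limits is defined. *)
have half (u' v' : nat -> R) (c' : R) (l : \bar R) :
    (forall n, u' n <= c' + v' n) -> (forall n, v' n <= c' + u' n) ->
    (u' n / n.+1%:R)%:E @[n --> \oo] --> l ->
    (v' n / n.+1%:R)%:E @[n --> \oo] --> l.
  move=> uv vu ul.
  have d0 : ((v' n - u' n) / n.+1%:R)%:E @[n --> \oo] --> (0 : R)%:E.
    apply: cvg_EFin; first by near=> n.
    apply: (@squeeze_cvgr _ _ _ _ (fun n => - c' * harmonic n) (fun n => c' * harmonic n)).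
    - near=> n; rewrite /harmonic /= !ler_pM2r ?invr_gt0//.
      by have := uv n; have := vu n => h1 h2; apply/andP; split; lra.
    - by rewrite -[X in _ --> X](mulr0 (- c')); apply: cvgMr; exact: cvg_harmonic.
    - by rewrite -[X in _ --> X](mulr0 c'); apply: cvgMr; exact: cvg_harmonic.
  have := cvgeD _ ul d0; rewrite adde0 => /(_ _).
  rewrite (_ : (fun n => _) = (fun n => (v' n / n.+1%:R)%:E)); last first.
    by apply/funext => n; rewrite -EFinD -mulrDl addrC subrK.
  by apply; rewrite fin_num_adde_defl.
move=> cfin ufin vfin uv vu.
have toR (w : nat -> \bar R) : (forall n, w n \is a fin_num) ->
    (fun n => w n / (n.+1%:R : R)%:E)%E =
    (fun n => (fine (w n) / n.+1%:R)%:E).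
  move=> wfin; apply/funext => n.
  by rewrite -{1}(fineK (wfin n)) inver pnatr_eq0.
rewrite (toR u)// (toR v)//.
congr (get _); apply/seteqP; split=> l; apply: (half _ _ (fine c)) => n;
  by rewrite -lee_fin EFinD !fineK.
Unshelve. all: by end_near.
Qed.

(** The error [cover_D a] is finite and independent of [n], so by [limn_div_eq] the term of [a] in
    the first supremum equals the term of [b] in the second. *)
Lemma mdim_nads_le (R : realType) (X : metricType R) (x0 : X)
    (F G : nat -> X -> X) :
  compact [set: X] ->
  (forall k, continuous (F k)) -> (forall k, continuous (G k)) ->
  (forall a : set (set X), open_cover a ->
    exists b : set (set X), [/\ open_cover b,
      forall n, (cover_D (cover_iter F a n) <=
                 cover_D a + cover_D (cover_iter G b n))%E &
      forall n, (cover_D (cover_iter G b n) <=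
                 cover_D a + cover_D (cover_iter F a n))%E]) ->
  (mdim_nads F <= mdim_nads G)%E.
Proof.
move=> Xcompact Fcont Gcont FG.
apply: ge_ereal_sup => _ [a /= acov <-]; have [b [bcov FGn GFn]] := FG a acov.
apply: ereal_sup_ubound; exists b => //=.
by apply: (@limn_div_eq _ _ _ (cover_D a)) => // [|n|n];
  apply: (cover_D_fin_num x0) => //; exact: open_cover_iter.
Qed.

Lemma cover_D_ge0 (R : realType) (X : metricType R) (x0 : X)
    (a : set (set X)) :
  compact [set: X] -> open_cover a -> (0 <= cover_D a)%E.
Proof. by move=> Xcompact /(cover_DP x0 Xcompact)[n _ ->]; rewrite lee_fin. Qed.

(** * Alternating systems and compositions *)

Lemma alternating_continuous (X : topologicalType) (f g : X -> X) (k : nat) :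
  continuous f -> continuous g -> continuous (alternating_nads f g k).
Proof. by rewrite /alternating_nads; case: odd. Qed.

Lemma alternating_shift (X : Type) (f g : X -> X) :
  alternating_nads f g \o S = alternating_nads g f.
Proof. by apply/funext => n; rewrite /alternating_nads /=; case: odd. Qed.

Lemma mdim_alternating_le (R : realType) (X : metricType R) (x0 : X)
    (f g : X -> X) :
  compact [set: X] -> continuous f -> continuous g ->
  (mdim_nads (alternating_nads f g) <= mdim_nads (alternating_nads g f))%E.
Proof.
move=> Xcompact fcont gcont.
have shiftD (h k : X -> X) (a : set (set X)) n :
    continuous h -> continuous k -> open_cover a ->
    (cover_D (cover_iter (alternating_nads h k) a n) <=
     cover_D a + cover_D (cover_iter (alternating_nads k h) a n))%E.
  (* The index is first raised to [n + 1], so that splitting off [a] leaves the shifted system at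
     index [n]. *)
  move=> hcont kcont acov; apply: le_trans (cover_D_iterS _ _ _) _.
  rewrite -(alternating_shift h k); apply: (cover_D_iter_shift x0) => // i.
  exact: alternating_continuous.
apply: (mdim_nads_le x0) => // [k|k|a acov].
- exact: alternating_continuous.
- exact: alternating_continuous.
by exists a; split=> // n; exact: shiftD.
Qed.

Lemma mdim_comp_le (R : realType) (X : metricType R) (x0 : X) (f g : X -> X) :
  compact [set: X] -> continuous f -> continuous g ->
  (mdim (f \o g) <= mdim (g \o f))%E.
Proof.
move=> Xcompact fcont gcont.
have compcont (h k : X -> X) : continuous h -> continuous k -> continuous (h \o k).
  by move=> hcont kcont x; apply: continuous_comp; [exact: kcont|exact: hcont].
apply: (mdim_nads_le x0) => // [k|k|a acov]; [exact: compcont..|].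
have fgcov n : open_cover (cover_iter (fun=> f \o g) a n).
  by apply: open_cover_iter => // _; exact: compcont.
have iterE n : cover_iter (fun=> g \o f) (cover_preimage f a) n =
    cover_preimage f (cover_iter (fun=> f \o g) a n).
  exact: cover_iter_preimage.
exists (cover_preimage f a); split=> [|n|n]; first exact: open_cover_preimage.
  (* At index [n + 1] the cover for [f \o g] is a v g^-1(f^-1(a_0^n)), whose inner preimage is the
     iterated cover of [g \o f] by [iterE]. *)
  apply: le_trans (cover_D_iterS _ _ _) _.
  rewrite cover_iterS -cover_preimage_comp iterE.
  apply: le_trans (cover_D_join x0 Xcompact acov _) _.
    by do 2 apply: open_cover_preimage => //.
  rewrite leeD2l//; apply: (cover_D_preimage x0) => //.
  exact: open_cover_preimage.
rewrite iterE; apply: (le_trans (cover_D_preimage x0 Xcompact fcont (fgcov n))).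
by rewrite leeDr//; exact: (cover_D_ge0 x0).
Qed.

Theorem corollary2p7 (R : realType) (X : metricType R) (f g : X -> X)
    (X_compact : compact [set: X]%classic)
    (f_cont : continuous f) (g_cont : continuous g) :
  mdim_nads (alternating_nads f g) = mdim_nads (alternating_nads g f) /\
  mdim (f \o g) = mdim (g \o f).
Proof.
(* Finiteness of D requires a point, as orders on the empty space are -oo; there, however, [f] and
   [g] are the same map. *)
have [[x0 _]|X0] := pselect (exists x : X, True); last first.
  suff -> : f = g by [].
  by apply/funext => x; case: X0; exists x.
split; apply: le_anti.
  by rewrite (mdim_alternating_le x0 X_compact f_cont g_cont)
    (mdim_alternating_le x0 X_compact g_cont f_cont).
by rewrite (mdim_comp_le x0 X_compact f_cont g_cont)
  (mdim_comp_le x0 X_compact g_cont f_cont).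
Qed.
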